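(* For any sequence of positive integers $A=A(n)\to\infty$ with $A(n)=o(n)$, as $n\to\infty$, \[ \Pr[BINGO(A,A;n,n)]\sim\Bigl(\frac{2\alpha-1}{\pi}\Bigr)^{1/2}A^{(2\alpha-1)/2}n^{-\alpha}. \]
   Context: Fix $\alpha>1$. Consider the Markov chain on $\mathbb N\times\mathbb N$ which from state $(i,j)$ moves to $(i+1,j)$ with probability $i^\alpha/(i^\alpha+j^\alpha)$ and to $(i,j+1)$ with probability $j^\alpha/(i^\alpha+j^\alpha)$. For $a\le c$, $b\le d$, $BINGO(a,b;c,d)$ denotes the event that this chain, started at state $(a,b)$, visits the state $(c,d)$. *)

(* Defs.v *)
From Stdlib Require Import Reals Arith.
Open Scope R_scope.

Definition wgt (alpha : R) (i : nat) : R := Rpower (INR i) alpha.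

Definition pstep1 (alpha : R) (i j : nat) : R :=
  wgt alpha i / (wgt alpha i + wgt alpha j).
Definition pstep2 (alpha : R) (i j : nat) : R :=
  wgt alpha j / (wgt alpha i + wgt alpha j).

(* hit alpha k i j c d = probability that the chain started at (i,j)
   is at (c,d) after exactly k steps (sum over all k-step paths of the
   product of transition probabilities, via first-step decomposition). *)
Fixpoint hit (alpha : R) (k i j c d : nat) : R :=
  match k with
  | O => if andb (Nat.eqb i c) (Nat.eqb j d) then 1 else 0
  | S k' => pstep1 alpha i j * hit alpha k' (S i) j c d
          + pstep2 alpha i j * hit alpha k' i (S j) c d
  end.

(* Each step raises i+j by exactly one, so the chain started at (a,b)
   visits (c,d) iff it is at (c,d) at time (c+d)-(a+b). *)
Definition BINGO (alpha : R) (a b c d : nat) : R :=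
  hit alpha ((c + d) - (a + b)) a b c d.

(* Main.v *)
Require Import Defs.
From Stdlib Require Import Reals Arith.
From Stdlib Require Import List Lra Lia.
From Coquelicot Require Import Coquelicot.
Open Scope R_scope.

(* Write w_k = k^alpha and b = 2 alpha - 1.  Embedding the chain in two independent pure
   birth processes with rates w_k and applying Plancherel suggests
     pi w_n Pr[BINGO(A,A;n,n)] = I := int prod_(A <= k <= n) 1 / (1 + s^2 / w_k^2) ds.
   It is proved without probability: the function
     F(i,j) = prod_(k >= i) 1 / (1 - is/w_k) * prod_(k >= j) 1 / (1 + is/w_k)
   satisfies the first-step equation of the chain pointwise in s, and by partial fractions
   the principal value of F vanishes once the chain has overshot (n,n).

   With sigma^2 = sum_(A <= k <= n) w_k^-2, AM-GM and Bernoulli's inequality compare the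
   product with powers of 1 / (1 + c s^2), whose integrals are controlled by Wallis'
   recursion; this gives pi <= I^2 sigma^2 <= pi * 2M / (2M - 3) for M = w_A^2 sigma^2.
   Finally b sigma^2 A^b lies between 1 - A/n and 1 + b/A. *)

(** * Improper integrals as limits over symmetric intervals *)

(** Continuity is built in so that every truncated integral exists; linearity and comparison then
    need no integrability side conditions. *)
Definition pv_int (f : R -> R) (l : R) : Prop :=
  (forall x, continuous f x) /\ is_lim (fun T => RInt f (- T) T) p_infty l.

Lemma ex_RInt_sym (f : R -> R) (T : R) :
  (forall x, continuous f x) -> ex_RInt f (- T) T.
Proof. intros Hf; apply (ex_RInt_continuous (V := R_CompleteNormedModule)); intros; apply Hf. Qed.

Lemma pv_int_ext (f g : R -> R) (l : R) :
  (forall x, f x = g x) -> pv_int f l -> pv_int g l.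
Proof.
  intros E [Hc Hl]; split.
  - intros x; apply (continuous_ext f); auto.
  - apply (is_lim_ext (fun T => RInt f (- T) T)); auto.
    intros T; apply RInt_ext; auto.
Qed.

Lemma pv_int_lin (a b : R) (f g : R -> R) (lf lg : R) :
  pv_int f lf -> pv_int g lg ->
  pv_int (fun x => a * f x + b * g x) (a * lf + b * lg).
Proof.
  intros [Cf Lf] [Cg Lg].
  assert (Cf' : forall x, continuous (fun x => a * f x) x)
    by (intros x; apply (continuous_scal_r a f x (Cf x))).
  assert (Cg' : forall x, continuous (fun x => b * g x) x)
    by (intros x; apply (continuous_scal_r b g x (Cg x))).
  split.
  - intros x; exact (continuous_plus _ _ x (Cf' x) (Cg' x)).
  - apply (is_lim_ext (fun T => a * RInt f (- T) T + b * RInt g (- T) T)).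
    + intros T. symmetry.
      rewrite (RInt_plus (V := R_CompleteNormedModule)
        (fun x => a * f x) (fun x => b * g x)) by (apply ex_RInt_sym; auto).
      apply (f_equal2 Rplus); apply (RInt_scal (V := R_CompleteNormedModule)); apply ex_RInt_sym; auto.
    + apply is_lim_plus'.
      * exact (is_lim_scal_l _ a _ _ Lf).
      * exact (is_lim_scal_l _ b _ _ Lg).
Qed.

Lemma pv_int_le (f g : R -> R) (lf lg : R) :
  (forall x, f x <= g x) -> pv_int f lf -> pv_int g lg -> lf <= lg.
Proof.
  intros E [Cf Lf] [Cg Lg].
  change (Rbar_le lf lg).
  apply (is_lim_le_loc (fun T => RInt f (- T) T) (fun T => RInt g (- T) T) p_infty);
    auto.
  exists 0; intros T HT.
  apply RInt_le; [lra | apply ex_RInt_sym; auto | apply ex_RInt_sym; auto | auto].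
Qed.

Lemma pv_int_dilate (c : R) (f : R -> R) (l : R) :
  0 < c -> pv_int f l -> pv_int (fun x => f (c * x)) (l / c).
Proof.
  intros Hc [Cf Lf]; split.
  - intros x; apply (continuous_comp (fun x => c * x) f); auto.
    apply (ex_derive_continuous (V := R_NormedModule)); auto_derive; auto.
  - apply (is_lim_ext (fun T => / c * RInt f (- (c * T)) (c * T))).
    + intros T.
      assert (E := RInt_comp_lin (V := R_CompleteNormedModule) f c 0 (- T) T).
      rewrite !Rplus_0_r, Ropp_mult_distr_r_reverse in E.
      rewrite <- E by (apply (ex_RInt_continuous (V := R_CompleteNormedModule)); intros; apply Cf).
      rewrite (RInt_scal (V := R_CompleteNormedModule)).
      2: { apply (ex_RInt_continuous (V := R_CompleteNormedModule)); intros.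
        apply (continuous_comp (fun x => c * x + 0) f); auto.
        apply (ex_derive_continuous (V := R_NormedModule)); auto_derive; auto. }
      change scal with Rmult; simpl; rewrite <- Rmult_assoc, Rinv_l, Rmult_1_l by lra.
      apply RInt_ext; intros; f_equal; ring.
    + replace (Finite (l / c)) with (Rbar_mult (/ c) l)
        by (simpl; f_equal; unfold Rdiv; ring).
      apply is_lim_scal_l.
      apply (is_lim_comp (fun T => RInt f (- T) T) (fun T => c * T) p_infty l p_infty); auto.
      * apply (is_lim_ext (fun T => c * T)); auto.
        replace p_infty with (Rbar_mult c p_infty) at 2.
        -- apply is_lim_scal_l; apply is_lim_id.
        -- simpl; destruct (Rle_dec 0 c) as [H|H]; [|lra].
           destruct (Rle_lt_or_eq_dec 0 c H); [reflexivity | lra].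
      * exists 0; intros; discriminate.
Qed.

Lemma pv_int_antiderivative (f G : R -> R) (l : R) :
  (forall x, continuous f x) -> (forall x, is_derive G x (f x)) ->
  is_lim (fun T => G T - G (- T)) p_infty l -> pv_int f l.
Proof.
  intros Cf HG HL; split; auto.
  apply (is_lim_ext (fun T => G T - G (- T))); auto.
  intros T; symmetry; apply is_RInt_unique.
  apply (is_RInt_derive G f); auto.
Qed.

(** Squeeze with an explicit error of order [1 / T], the form in which all boundary terms of
    antiderivatives are estimated below. *)
Lemma is_lim_inv_bound (f : R -> R) (l c : R) :
  (forall T, 1 <= T -> Rabs (f T - l) <= c / T) -> is_lim f p_infty l.
Proof.
  intros H.
  assert (L : forall e : R, is_lim (fun T => l + e * / T) p_infty l).
  { intros e. replace (Finite l) with (Finite (l + e * 0)) by (f_equal; ring).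
    apply is_lim_plus'; [apply is_lim_const|].
    apply (is_lim_scal_l Rinv e p_infty 0).
    apply (is_lim_inv (fun x => x) p_infty p_infty); [apply is_lim_id | discriminate]. }
  apply (is_lim_le_le_loc (fun T => l + - c * / T) (fun T => l + c * / T)); auto.
  exists 1; intros T HT.
  assert (H1 := H T (Rlt_le _ _ HT)). apply Rabs_le_between in H1.
  unfold Rdiv in H1. lra.
Qed.

Lemma pv_int_cauchy (a : R) :
  0 < a -> pv_int (fun s => / (1 + (s / a) ^ 2)) (PI * a).
Proof.
  intros Ha.
  assert (B : pv_int (fun s => / (1 + s ^ 2)) PI).
  { apply (pv_int_antiderivative _ atan).
    - intros x; apply (ex_derive_continuous (V := R_NormedModule)); auto_derive; nra.
    - intros x; rewrite <- Rsqr_pow2; apply is_derive_atan.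
    - apply (is_lim_inv_bound _ _ 2); intros T HT.
      rewrite atan_opp.
      assert (E := atan_inv T ltac:(lra)).
      assert (Hp : 0 < / T) by (apply Rinv_0_lt_compat; lra).
      assert (P := atan_increasing 0 (/ T) Hp). rewrite atan_0 in P.
      (* By reflection the two missing tails amount to [2 * atan (/ T)]; the mean value theorem
         bounds this by [2 / T]. *)
      assert (L : atan (/ T) <= / T).
      { destruct (MVT_gen atan 0 (/ T) (fun x => / (1 + x²))) as [c [_ Hc]].
        - intros x _; apply is_derive_atan.
        - intros x _; apply derivable_continuous_pt, derivable_pt_atan.
        - rewrite atan_0, !Rminus_0_r in Hc. rewrite Hc.
          assert (/ (1 + c²) <= / 1)
            by (apply Rinv_le_contravar; [lra | generalize (Rle_0_sqr c); lra]).
          rewrite Rinv_1 in H. nra. }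
      replace (atan T - - atan T - PI) with (- (2 * atan (/ T))) by lra.
      rewrite Rabs_Ropp, Rabs_pos_eq by lra. unfold Rdiv; lra. }
  apply (pv_int_ext (fun s => / (1 + (/ a * s) ^ 2))).
  - intros x; do 2 f_equal; unfold Rdiv; ring.
  - replace (PI * a) with (PI / / a) by (field; lra).
    apply (pv_int_dilate (/ a) (fun s => / (1 + s ^ 2))); auto.
    apply Rinv_0_lt_compat; auto.
Qed.

(** * Half-integer powers of the Cauchy kernel and Wallis' recursion *)

(** The power [m / 2] of [1 / (1 + s^2)]. Odd [m] are included because the product of two
    consecutive integrals has a closed form. *)
Definition kern (m : nat) (s : R) : R := / sqrt (1 + s ^ 2) ^ m.

Lemma sqrt_1_plus_sqr_ge_1 (s : R) : 1 <= sqrt (1 + s ^ 2).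
Proof. rewrite <- sqrt_1 at 1; apply sqrt_le_1_alt; nra. Qed.

Lemma sqrt_1_plus_sqr_sqr (s : R) : sqrt (1 + s ^ 2) ^ 2 = 1 + s ^ 2.
Proof. rewrite <- Rsqr_pow2; apply Rsqr_sqrt; nra. Qed.

Lemma kern_pos (m : nat) (s : R) : 0 < kern m s.
Proof.
  apply Rinv_0_lt_compat, pow_lt. generalize (sqrt_1_plus_sqr_ge_1 s); lra.
Qed.

Lemma kern_add2 (m : nat) (s : R) : kern m s = (1 + s ^ 2) * kern (S (S m)) s.
Proof.
  unfold kern. rewrite <- sqrt_1_plus_sqr_sqr at 2. simpl.
  generalize (sqrt_1_plus_sqr_ge_1 s); intros H.
  assert (sqrt (1 + s * (s * 1)) ^ m <> 0) by (apply pow_nonzero; simpl in H; lra).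
  field; simpl in H; split; [auto | lra].
Qed.

Lemma is_derive_kern (m : nat) (s : R) :
  is_derive (kern m) s (- INR m * s * kern (S (S m)) s).
Proof.
  unfold kern.
  assert (H := sqrt_1_plus_sqr_ge_1 s).
  assert (H2 := sqrt_1_plus_sqr_sqr s).
  assert (Hm : sqrt (1 + s ^ 2) ^ m <> 0) by (apply pow_nonzero; lra).
  auto_derive; [split; [nra | split; [exact Hm | auto]] |].
  replace (s * (s * 1)) with (s ^ 2) by ring.
  destruct m as [|m]; [simpl; field; simpl in H; lra|].
  replace (Init.Nat.pred (S m)) with m by reflexivity.
  set (r := sqrt (1 + s ^ 2)) in *.
  assert (r ^ m <> 0) by (apply pow_nonzero; lra).
  replace (r ^ S (S (S m))) with (r * r * r * r ^ m) by (simpl; ring).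
  replace (r ^ S m) with (r * r ^ m) by (simpl; ring).
  field; repeat split; auto; lra.
Qed.

Lemma continuous_kern (m : nat) (s : R) : continuous (kern m) s.
Proof.
  apply (ex_derive_continuous (V := R_NormedModule)).
  eexists; apply is_derive_kern.
Qed.

Lemma kern_le (m p : nat) (s : R) : (m <= p)%nat -> kern p s <= kern m s.
Proof.
  intros H; apply Rinv_le_contravar.
  - apply pow_lt; generalize (sqrt_1_plus_sqr_ge_1 s); lra.
  - apply Rle_pow; auto; apply sqrt_1_plus_sqr_ge_1.
Qed.

Lemma kern_even (m : nat) (s : R) : kern m (- s) = kern m s.
Proof. unfold kern; replace ((- s) ^ 2) with (s ^ 2) by ring; reflexivity. Qed.

Lemma kern_2 (s : R) : kern 2 s = / (1 + s ^ 2).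
Proof. unfold kern; rewrite sqrt_1_plus_sqr_sqr; reflexivity. Qed.

Lemma kern_double (N : nat) (s : R) : kern (2 * N) s = / (1 + s ^ 2) ^ N.
Proof. unfold kern; rewrite pow_mult, sqrt_1_plus_sqr_sqr; reflexivity. Qed.

(* The index is shifted: [kern_int m] is the integral of [kern (m + 2)]. *)
Fixpoint kern_int (m : nat) : R :=
  match m with
  | O => PI
  | S O => 2
  | S (S k) => kern_int k * (INR k + 1) / (INR k + 2)
  end.

Lemma nat_ind2 (P : nat -> Prop) :
  P O -> P 1%nat -> (forall m, P m -> P (S (S m))) -> forall m, P m.
Proof.
  intros H0 H1 HS m.
  assert (P m /\ P (S m)) as [H _]; [|exact H].
  induction m as [|m [IH IH']]; auto.
Qed.

(** The base cases have antiderivatives [atan s] and [s * kern 1 s]. For the step, the derivative of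
    [s * kern M s] is [(1 - M) * kern M s + M * kern (M + 2) s], and its boundary terms vanish at
    infinity. *)
Lemma pv_int_kern (m : nat) : pv_int (kern (S (S m))) (kern_int m).
Proof.
  induction m as [| |m IH] using nat_ind2.
  - apply (pv_int_ext (fun s => / (1 + (s / 1) ^ 2))).
    + intros s; rewrite kern_2, Rdiv_1_r; reflexivity.
    + simpl; rewrite <- (Rmult_1_r PI); apply pv_int_cauchy; lra.
  - apply (pv_int_antiderivative _ (fun s => s * kern 1 s)).
    + intros s; apply continuous_kern.
    + intros s.
      replace (kern 3 s) with (1 * kern 1 s + s * (- INR 1 * s * kern 3 s)).
      * apply (is_derive_mult (fun s : R => s) (kern 1) s 1).
        -- apply (is_derive_id (K := R_AbsRing)).
        -- apply is_derive_kern.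
        -- intros; apply Rmult_comm.
      * rewrite (kern_add2 1); simpl; ring.
    + apply (is_lim_inv_bound _ _ 2); intros T HT.
      rewrite kern_even.
      unfold kern; rewrite pow_1.
      assert (H2 := sqrt_1_plus_sqr_sqr T).
      assert (H1 := sqrt_1_plus_sqr_ge_1 T).
      set (r := sqrt (1 + T ^ 2)) in *; simpl in *.
      assert (T <= r) by nra. assert (r - T <= 1) by nra.
      replace (T * / r - - T * / r - 2) with (- (2 * ((r - T) / r))) by (field; lra).
      rewrite Rabs_Ropp, Rabs_pos_eq.
      * apply Rmult_le_compat_l; [lra|]. apply Rle_div_l; [lra|].
        replace (/ T * r) with (r / T) by (unfold Rdiv; ring).
        apply Rle_div_r; nra.
      * apply Rmult_le_pos; [lra|]. apply Rdiv_le_0_compat; lra.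
  - set (M := INR (S (S m))).
    assert (HM : M = INR m + 2) by (unfold M; rewrite !S_INR; ring).
    assert (H0 : 0 <= INR m) by apply pos_INR.
    assert (B : pv_int (fun s => (1 - M) * kern (S (S m)) s + M * kern (S (S (S (S m)))) s) 0).
    { apply (pv_int_antiderivative _ (fun s => s * kern (S (S m)) s)).
      - intros s.
        apply (continuous_plus (fun s => (1 - M) * kern _ s) (fun s => M * kern _ s));
          apply (continuous_scal_r (K := R_AbsRing) (V := R_NormedModule)); apply continuous_kern.
      - intros s.
        replace (_ + _) with (1 * kern (S (S m)) s + s * (- M * s * kern (S (S (S (S m)))) s)).
        + apply (is_derive_mult (fun s : R => s) (kern (S (S m))) s 1).
          * apply (is_derive_id (K := R_AbsRing)).
          * apply is_derive_kern.
          * intros; apply Rmult_comm.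
        + rewrite (kern_add2 (S (S m))); ring.
      - apply (is_lim_inv_bound _ _ 2); intros T HT.
        rewrite kern_even.
        replace (_ - _ - 0) with (2 * (T * kern (S (S m)) T)) by ring.
        assert (Hk := kern_pos (S (S m)) T).
        assert (Hk2 := kern_le 2 (S (S m)) T ltac:(lia)).
        rewrite kern_2 in Hk2.
        rewrite Rabs_pos_eq by nra.
        apply Rmult_le_compat_l; [lra|].
        apply Rle_trans with (T * / (1 + T ^ 2)); [apply Rmult_le_compat_l; lra|].
        apply Rle_div_l; [nra|].
        replace (/ T * (1 + T ^ 2)) with ((1 + T ^ 2) / T) by (unfold Rdiv; ring).
        apply Rle_div_r; nra. }
    apply (pv_int_ext (fun s => / M * ((1 - M) * kern (S (S m)) s + M * kern (S (S (S (S m)))) s)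
                           + (M - 1) / M * kern (S (S m)) s)).
    + intros s; field; lra.
    + replace (kern_int (S (S m))) with (/ M * 0 + (M - 1) / M * kern_int m).
      * apply pv_int_lin; auto.
      * simpl kern_int; rewrite HM; field; lra.
Qed.

(** The recursion leaves this product unchanged as [m] grows, and at [m = 0] it is [PI * 2].
    Together with monotonicity in [m] it bounds the squares from both sides. *)
Lemma kern_int_mul (m : nat) : kern_int m * kern_int (S m) * (INR m + 1) = 2 * PI.
Proof.
  induction m as [|m IH]; [simpl; ring|].
  rewrite <- IH; simpl kern_int at 2; rewrite S_INR.
  field; generalize (pos_INR m); lra.
Qed.

Lemma kern_int_decr (m : nat) : kern_int (S m) <= kern_int m.
Proof.
  apply (pv_int_le (kern (S (S (S m)))) (kern (S (S m)))); try apply pv_int_kern.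
  intros s; apply kern_le; lia.
Qed.

Lemma kern_int_pos (m : nat) : 0 < kern_int m.
Proof.
  induction m as [| |m IH] using nat_ind2; [apply PI_RGT_0 | simpl; lra |].
  simpl; generalize (pos_INR m); intros. apply Rdiv_lt_0_compat; nra.
Qed.

Lemma kern_int_sqr_lower (m : nat) : 2 * PI / (INR m + 1) <= kern_int m ^ 2.
Proof.
  generalize (pos_INR m) (kern_int_mul m) (kern_int_decr m) (kern_int_pos m); intros.
  apply Rle_div_l; [lra|]. rewrite <- H0; apply Rmult_le_compat_r; [lra | nra].
Qed.

Lemma kern_int_sqr_upper (m : nat) : kern_int (S m) ^ 2 <= 2 * PI / (INR m + 1).
Proof.
  generalize (pos_INR m) (kern_int_mul m) (kern_int_decr m) (kern_int_pos (S m)); intros.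
  apply (Rle_div_r (kern_int (S m) ^ 2)); [lra|]. rewrite <- H0; apply Rmult_le_compat_r; [lra | nra].
Qed.

(** * Products of resolvents and partial fractions *)

(* [1 / (1 + i s / a)], the Fourier transform of the exponential law of rate [a]. *)
Definition resolvent (a s : R) : C :=
  (/ (1 + (s / a) ^ 2), - (s / a) / (1 + (s / a) ^ 2)).

Lemma resolvent_Cinv (a s : R) : resolvent a s = Cinv (1, s / a).
Proof.
  unfold resolvent, Cinv; simpl; set (t := s / a).
  f_equal; field; nra.
Qed.

Definition resolvents (l : list R) (s : R) : C :=
  fold_right (fun a z => Cmult (resolvent a s) z) (RtoC 1) l.

(** Only real parts are integrated. This suffices since all combinations taken below have real
    coefficients, and it avoids the imaginary part of a single [resolvent], which is not absolutely
    integrable. *)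
Definition pv_re (F : R -> C) (l : R) : Prop := pv_int (fun s => Re (F s)) l.

Lemma pv_re_ext (F G : R -> C) (l : R) :
  (forall s, F s = G s) -> pv_re F l -> pv_re G l.
Proof. intros E; apply pv_int_ext; intros s; rewrite E; reflexivity. Qed.

Lemma pv_re_lin (a b : R) (F G : R -> C) (lf lg : R) :
  pv_re F lf -> pv_re G lg ->
  pv_re (fun s => Cplus (Cmult (RtoC a) (F s)) (Cmult (RtoC b) (G s))) (a * lf + b * lg).
Proof.
  intros HF HG.
  apply (pv_int_ext (fun s => a * Re (F s) + b * Re (G s))).
  - intros s; unfold Re, Cplus, Cmult, RtoC; simpl; ring.
  - apply pv_int_lin; auto.
Qed.

Lemma pv_re_conj (F : R -> C) (l : R) : pv_re F l -> pv_re (fun s => Cconj (F s)) l.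
Proof. apply pv_int_ext; reflexivity. Qed.

Lemma pv_re_resolvent (a : R) : 0 < a -> pv_re (resolvent a) (PI * a).
Proof. intros Ha; exact (pv_int_cauchy a Ha). Qed.

Lemma one_plus_I_neq_0 (x : R) : ((1, x) : C) <> RtoC 0.
Proof. intros H; injection H; lra. Qed.

(** The variable cancels in [b (1 + is/b) - a (1 + is/a) = b - a]; dividing by [b - a] and by both
    factors gives the decomposition. *)
Lemma resolvent_partial_fractions (a b s : R) :
  0 < a -> 0 < b -> a <> b ->
  Cmult (resolvent a s) (resolvent b s)
  = Cplus (Cmult (RtoC (b / (b - a))) (resolvent a s))
          (Cmult (RtoC (- a / (b - a))) (resolvent b s)).
Proof.
  intros Ha Hb Hab. rewrite !resolvent_Cinv.
  assert (Na := one_plus_I_neq_0 (s / a)). assert (Nb := one_plus_I_neq_0 (s / b)).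
  assert (E : RtoC 1 = Cplus (Cmult (RtoC (b / (b - a))) (1, s / b))
                             (Cmult (RtoC (- a / (b - a))) (1, s / a))).
  { unfold RtoC, Cplus, Cmult; simpl; f_equal; field; lra. }
  set (za := ((1, s / a) : C)) in *. set (zb := ((1, s / b) : C)) in *.
  replace (Cmult (Cinv za) (Cinv zb)) with (Cmult (RtoC 1) (Cmult (Cinv za) (Cinv zb))) by ring.
  rewrite E at 1; field; auto.
Qed.

(** In probabilistic terms, a sum of at least two independent exponential variables has density 0 at
    the origin. Partial fractions in the first two rates reduce to shorter lists; for two rates the
    contributions [PI * a] and [PI * b] cancel. *)
Lemma pv_re_resolvents_0 (l : list R) (a b : R) :
  NoDup (a :: b :: l) -> (forall x, In x (a :: b :: l) -> 0 < x) ->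
  pv_re (resolvents (a :: b :: l)) 0.
Proof.
  revert a b; induction l as [|c l IH]; intros a b Hd Hp.
  - assert (a <> b).
    { intros E; inversion Hd as [|? ? H1 _]; apply H1; left; auto. }
    assert (Ha : 0 < a) by (apply Hp; simpl; auto).
    assert (Hb : 0 < b) by (apply Hp; simpl; auto).
    apply (pv_re_ext (fun s => Cplus (Cmult (RtoC (b / (b - a))) (resolvent a s))
                         (Cmult (RtoC (- a / (b - a))) (resolvent b s)))).
    + intros s; rewrite <- resolvent_partial_fractions by auto; simpl; ring.
    + replace 0 with (b / (b - a) * (PI * a) + - a / (b - a) * (PI * b)) by (field; lra).
      apply pv_re_lin; apply pv_re_resolvent; auto.
  - inversion Hd as [|? ? Hna Hd1]; subst. inversion Hd1 as [|? ? Hnb Hd2]; subst.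
    assert (a <> b) by (intros E; apply Hna; left; auto).
    apply (pv_re_ext (fun s => Cplus (Cmult (RtoC (b / (b - a))) (resolvents (a :: c :: l) s))
                         (Cmult (RtoC (- a / (b - a))) (resolvents (b :: c :: l) s)))).
    + intros s; simpl.
      assert (E := resolvent_partial_fractions a b s
        (Hp a ltac:(simpl; auto)) (Hp b ltac:(simpl; auto)) H).
      set (z := Cmult (resolvent c s) _).
      transitivity (Cmult (Cmult (resolvent a s) (resolvent b s)) z); [rewrite E; ring | ring].
    + replace 0 with (b / (b - a) * 0 + - a / (b - a) * 0) by ring.
      apply pv_re_lin; apply IH; auto.
      * constructor; auto; intros Hin; apply Hna; right; auto.
      * intros x [Hx|Hx]; apply Hp; simpl in *; auto.
      * intros x Hx; apply Hp; simpl in *; auto.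
Qed.

(** * The birth rates as a list of distinct positive numbers *)

Lemma wgt_pos (alpha : R) (i : nat) : 0 < wgt alpha i.
Proof. apply exp_pos. Qed.

Lemma wgt_lt (alpha : R) (i j : nat) :
  0 < alpha -> (1 <= i < j)%nat -> wgt alpha i < wgt alpha j.
Proof.
  intros Ha [Hi Hj]; apply Rlt_Rpower_l; auto; split.
  - apply lt_0_INR; lia.
  - apply lt_INR; auto.
Qed.

(** At [i = S n] the list is empty, which encodes a coordinate that has overshot [n]. *)
Definition rates (alpha : R) (i n : nat) : list R := map (wgt alpha) (seq i (S n - i)).

Lemma rates_cons (alpha : R) (i n : nat) :
  (i <= n)%nat -> rates alpha i n = wgt alpha i :: rates alpha (S i) n.
Proof.
  intros H; unfold rates; replace (S n - i)%nat with (S (S n - S i)) by lia; reflexivity.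
Qed.

Lemma rates_nil (alpha : R) (n : nat) : rates alpha (S n) n = nil.
Proof. unfold rates; rewrite Nat.sub_diag; reflexivity. Qed.

Lemma rates_pos (alpha : R) (i n : nat) (x : R) : In x (rates alpha i n) -> 0 < x.
Proof.
  intros H; apply in_map_iff in H; destruct H as [k [<- _]]; apply wgt_pos.
Qed.

Lemma rates_NoDup (alpha : R) (i n : nat) :
  0 < alpha -> (1 <= i)%nat -> NoDup (rates alpha i n).
Proof.
  intros Ha Hi; apply NoDup_map_NoDup_ForallPairs; [|apply seq_NoDup].
  intros x y Hx Hy E; apply in_seq in Hx; apply in_seq in Hy.
  destruct (Nat.lt_total x y) as [H|[H|H]]; auto.
  - generalize (wgt_lt alpha x y Ha ltac:(lia)); lra.
  - generalize (wgt_lt alpha y x Ha ltac:(lia)); lra.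
Qed.

(** * The exact integral formula for the hitting probability *)

Lemma hit_overshoot (alpha : R) (k i j c d : nat) :
  (c < i \/ d < j)%nat -> hit alpha k i j c d = 0.
Proof.
  revert i j; induction k as [|k IH]; intros i j H; simpl.
  - destruct H as [H|H].
    + replace (Nat.eqb i c) with false by (symmetry; apply Nat.eqb_neq; lia); reflexivity.
    + replace (Nat.eqb j d) with false by (symmetry; apply Nat.eqb_neq; lia).
      rewrite Bool.andb_false_r; reflexivity.
  - rewrite !IH by lia; ring.
Qed.

Lemma pv_re_rates_0 (alpha : R) (i n : nat) :
  0 < alpha -> (1 <= i < n)%nat -> pv_re (resolvents (rates alpha i n)) 0.
Proof.
  intros Ha Hi.
  assert (Hd := rates_NoDup alpha i n Ha (proj1 Hi)).
  assert (Hp := rates_pos alpha i n).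
  rewrite (rates_cons alpha i), (rates_cons alpha (S i)) in * by lia.
  apply pv_re_resolvents_0; auto.
Qed.

(** The function [F] of the opening comment, with the products stopped at [n]. It is the Fourier
    transform of the difference of the times at which the two birth processes leave [n]; the
    conjugate accounts for the minus sign. *)
Definition bingo_kernel (alpha : R) (i j n : nat) (s : R) : C :=
  Cmult (Cconj (resolvents (rates alpha i n) s)) (resolvents (rates alpha j n) s).

(** With [u], [v] the two current rates, the imaginary parts cancel in
    [u (1 - is/u) + v (1 + is/v) = u + v]. *)
Lemma bingo_kernel_harmonic (alpha : R) (i j n : nat) (s : R) :
  (i <= n)%nat -> (j <= n)%nat ->
  bingo_kernel alpha i j n s
  = Cplus (Cmult (RtoC (pstep1 alpha i j)) (bingo_kernel alpha (S i) j n s))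
          (Cmult (RtoC (pstep2 alpha i j)) (bingo_kernel alpha i (S j) n s)).
Proof.
  intros Hi Hj; unfold bingo_kernel, pstep1, pstep2.
  rewrite (rates_cons alpha i), (rates_cons alpha j) by auto; simpl resolvents.
  assert (Hu := wgt_pos alpha i). assert (Hv := wgt_pos alpha j).
  set (u := wgt alpha i) in *; set (v := wgt alpha j) in *.
  set (zi := resolvents (rates alpha (S i) n) s).
  set (zj := resolvents (rates alpha (S j) n) s).
  rewrite !Cmult_conj, !resolvent_Cinv, Cinv_conj by apply one_plus_I_neq_0.
  replace (Cconj (1, s / u)) with ((1, - (s / u)) : C) by reflexivity.
  assert (Nu := one_plus_I_neq_0 (- (s / u))). assert (Nv := one_plus_I_neq_0 (s / v)).
  assert (E : RtoC 1 = Cplus (Cmult (RtoC (u / (u + v))) (1, - (s / u)))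
                             (Cmult (RtoC (v / (u + v))) (1, s / v))).
  { unfold RtoC, Cplus, Cmult; simpl; f_equal; field; lra. }
  set (a := ((1, - (s / u)) : C)) in *. set (b := ((1, s / v) : C)) in *.
  match goal with |- ?l = _ => replace l with (Cmult (RtoC 1) l) by ring end.
  rewrite E at 1; field; auto.
Qed.

(** Both sides satisfy the same first-step equation, so induction on the number [k] of remaining
    steps leaves only boundary values. If one coordinate is [S n], the other is below [n], so at
    least two rates remain and the integral vanishes. *)
Lemma pv_re_bingo_kernel (alpha : R) (n k i j : nat) :
  0 < alpha -> (1 <= i <= S n)%nat -> (1 <= j <= S n)%nat -> (i + j + k = 2 * n)%nat ->
  pv_re (bingo_kernel alpha i j n) (PI * wgt alpha n * hit alpha k i j n n).
Proof.
  intros Ha; revert i j; induction k as [|k IH]; intros i j Hi Hj Hk.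
  all: destruct (Nat.eq_dec i (S n)) as [->|Ni];
    [ rewrite hit_overshoot, Rmult_0_r by lia;
      apply (pv_re_ext (resolvents (rates alpha j n)));
      [ intros s; unfold bingo_kernel; rewrite rates_nil; simpl;
        unfold Cconj, Cmult; destruct (resolvents _ s); simpl; f_equal; ring
      | apply pv_re_rates_0; auto; lia ] | ].
  all: destruct (Nat.eq_dec j (S n)) as [->|Nj];
    [ rewrite hit_overshoot, Rmult_0_r by lia;
      apply (pv_re_ext (fun s => Cconj (resolvents (rates alpha i n) s)));
      [ intros s; unfold bingo_kernel; rewrite rates_nil; simpl; ring
      | apply pv_re_conj, pv_re_rates_0; auto; lia ] | ].
  (* At the target only the rate of [n] is left in each factor; the kernel is a Cauchy kernel of
     scale [wgt alpha n], the source of the normalisation [PI * wgt alpha n]. *)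
  - assert (i = n) by lia; assert (j = n) by lia; subst i j.
    simpl hit; rewrite Nat.eqb_refl; simpl; rewrite Rmult_1_r.
    apply (pv_int_ext (fun s => / (1 + (s / wgt alpha n) ^ 2))).
    + intros s; unfold bingo_kernel.
      rewrite rates_cons, rates_nil by lia; unfold resolvents, resolvent; simpl.
      assert (0 < 1 + s / wgt alpha n * (s / wgt alpha n * 1)) by nra.
      set (t := s / wgt alpha n) in *; field; lra.
    + apply pv_int_cauchy, wgt_pos.
  - simpl hit.
    apply (pv_re_ext (fun s => Cplus
      (Cmult (RtoC (pstep1 alpha i j)) (bingo_kernel alpha (S i) j n s))
      (Cmult (RtoC (pstep2 alpha i j)) (bingo_kernel alpha i (S j) n s)))).
    + intros s; symmetry; apply bingo_kernel_harmonic; lia.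
    + match goal with |- pv_re _ ?v => replace v with
       (pstep1 alpha i j * (PI * wgt alpha n * hit alpha k (S i) j n n) +
        pstep2 alpha i j * (PI * wgt alpha n * hit alpha k i (S j) n n)) by ring end.
      apply pv_re_lin; apply IH; lia.
Qed.

(** * The product of Lorentzians and its lower bound by AM-GM *)

Definition lorentz_prod (l : list R) (s : R) : R :=
  fold_right (fun a p => / (1 + (s / a) ^ 2) * p) 1 l.

Lemma resolvents_norm (l : list R) (s : R) :
  Re (Cmult (Cconj (resolvents l s)) (resolvents l s)) = lorentz_prod l s.
Proof.
  induction l as [|a l IH]; simpl; [ring|].
  rewrite <- IH; unfold resolvent; simpl.
  assert (0 < 1 + s / a * (s / a * 1)) by nra.
  set (t := s / a) in *; destruct (resolvents l s) as [x y]; simpl; field; lra.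
Qed.

Lemma pv_int_bingo (alpha : R) (a n : nat) :
  0 < alpha -> (1 <= a <= n)%nat ->
  pv_int (lorentz_prod (rates alpha a n)) (PI * wgt alpha n * BINGO alpha a a n n).
Proof.
  intros Ha Hn.
  apply (pv_int_ext (fun s => Re (bingo_kernel alpha a a n s))).
  - intros s; apply resolvents_norm.
  - apply pv_re_bingo_kernel; auto; lia.
Qed.

(** For the rates from [A] to [n] this is the [sigma^2] of the opening comment. *)
Definition inv_sqr_sum (l : list R) : R := fold_right (fun a p => / a ^ 2 + p) 0 l.

Lemma inv_sqr_sum_nonneg (l : list R) : (forall x, In x l -> 0 < x) -> 0 <= inv_sqr_sum l.
Proof.
  induction l as [|a l IH]; intros Hp; [simpl; lra|].
  assert (0 < a) by (apply Hp; simpl; auto).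
  assert (0 < / a ^ 2) by (apply Rinv_0_lt_compat; nra).
  assert (0 <= inv_sqr_sum l) by (apply IH; intros; apply Hp; simpl; auto).
  change (0 <= / a ^ 2 + inv_sqr_sum l); lra.
Qed.

Lemma inv_sqr_sum_pos (a : R) (l : list R) :
  (forall x, In x (a :: l) -> 0 < x) -> 0 < inv_sqr_sum (a :: l).
Proof.
  intros Hp.
  assert (0 < a) by (apply Hp; simpl; auto).
  assert (0 < / a ^ 2) by (apply Rinv_0_lt_compat; nra).
  assert (0 <= inv_sqr_sum l) by (apply inv_sqr_sum_nonneg; intros; apply Hp; simpl; auto).
  change (0 < / a ^ 2 + inv_sqr_sum l); lra.
Qed.

Lemma lorentz_prod_nonneg (l : list R) (s : R) : 0 <= lorentz_prod l s.
Proof.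
  induction l as [|a l IH]; simpl; [lra|].
  apply Rmult_le_pos; auto. apply Rlt_le, Rinv_0_lt_compat; nra.
Qed.

(* Tangent line of [ln] at [1 + m]; with [m] the mean of the [x]'s the exponentials
   multiply to [1], which gives AM-GM. *)
Lemma one_plus_le_exp_mean (x m : R) :
  0 <= m -> 1 + x <= (1 + m) * exp ((x - m) / (1 + m)).
Proof.
  intros Hm.
  assert (H := exp_ineq1_le ((x - m) / (1 + m))).
  apply Rle_trans with ((1 + m) * (1 + (x - m) / (1 + m))).
  - right; field; lra.
  - apply Rmult_le_compat_l; lra.
Qed.

(** Tangent bounds multiplied over the list with [m] left free for the induction. The exponential
    becomes 1 once [m] is the mean of the numbers [(s / a)^2]. *)
Lemma lorentz_prod_tangent (l : list R) (s m : R) :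
  0 <= m -> (forall x, In x l -> 0 < x) ->
  (/ (1 + m)) ^ length l
    * exp ((INR (length l) * m - s ^ 2 * inv_sqr_sum l) / (1 + m)) <= lorentz_prod l s.
Proof.
  intros Hm; induction l as [|a l IH]; intros Hp.
  - simpl; right.
    replace ((0 * m - s * (s * 1) * 0) / (1 + m)) with 0 by (field; lra).
    rewrite exp_0; ring.
  - assert (Ha : 0 < a) by (apply Hp; simpl; auto).
    specialize (IH (fun x Hx => Hp x (or_intror Hx))).
    change (lorentz_prod (a :: l) s) with (/ (1 + (s / a) ^ 2) * lorentz_prod l s).
    change (inv_sqr_sum (a :: l)) with (/ a ^ 2 + inv_sqr_sum l).
    change (length (a :: l)) with (S (length l)).
    rewrite S_INR.
    replace (((INR (length l) + 1) * m - s ^ 2 * (/ a ^ 2 + inv_sqr_sum l)) / (1 + m))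
      with (- (((s / a) ^ 2 - m) / (1 + m))
            + (INR (length l) * m - s ^ 2 * inv_sqr_sum l) / (1 + m)) by (field; lra).
    rewrite exp_plus, exp_Ropp.
    assert (H := one_plus_le_exp_mean ((s / a) ^ 2) m Hm).
    assert (0 <= (s / a) ^ 2) by apply pow2_ge_0.
    set (E := exp (((s / a) ^ 2 - m) / (1 + m))) in *.
    assert (0 < E) by apply exp_pos.
    simpl pow at 1.
    match goal with |- ?q * ?p * (_ * ?e) <= _ =>
      replace (q * p * (/ E * e)) with (/ ((1 + m) * E) * (p * e)) by (field; lra) end.
    apply Rmult_le_compat; auto.
    + apply Rlt_le, Rinv_0_lt_compat; nra.
    + apply Rmult_le_pos; [apply pow_le, Rlt_le, Rinv_0_lt_compat; lra | apply Rlt_le, exp_pos].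
    + apply Rinv_le_contravar; lra.
Qed.

(** Let [N] be the length and [c^2 = sigma^2 / N]. By AM-GM the product is at least
    [1 / (1 + c^2 s^2)^N], so [I >= K / c] with [K] a Wallis integral and [K^2 >= 2 PI / (2 N - 1)].
    Hence [I^2 sigma^2 >= K^2 N >= PI]. *)
Lemma pv_int_lorentz_lower (a : R) (l : list R) (I : R) :
  (forall x, In x (a :: l) -> 0 < x) -> pv_int (lorentz_prod (a :: l)) I ->
  0 < I /\ PI <= I ^ 2 * inv_sqr_sum (a :: l).
Proof.
  intros Hp HI.
  assert (HS := inv_sqr_sum_pos a l Hp).
  set (S2 := inv_sqr_sum (a :: l)) in *.
  set (N := length (a :: l)).
  assert (HN : INR N = INR (length l) + 1) by (unfold N; simpl length; apply S_INR).
  assert (Hl := pos_INR (length l)).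
  set (c := sqrt (S2 / INR N)).
  assert (Hq : 0 < S2 / INR N) by (apply Rdiv_lt_0_compat; lra).
  assert (Hc : 0 < c) by (apply sqrt_lt_R0; auto).
  assert (Hc2 : c ^ 2 = S2 / INR N) by (rewrite <- Rsqr_pow2; apply Rsqr_sqrt; lra).
  assert (HK : pv_int (fun s => kern (2 * N) (c * s)) (kern_int (2 * length l) / c)).
  { apply pv_int_dilate; auto.
    replace (2 * N)%nat with (S (S (2 * length l))) by (unfold N; simpl length; lia).
    apply pv_int_kern. }
  assert (Hle : kern_int (2 * length l) / c <= I).
  { refine (pv_int_le _ _ _ _ _ HK HI); intros s; cbv beta.
    rewrite kern_double.
    assert (0 <= (c * s) ^ 2) by apply pow2_ge_0.
    assert (T := lorentz_prod_tangent (a :: l) s ((c * s) ^ 2) ltac:(auto) Hp).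
    fold N S2 in T.
    replace ((INR N * (c * s) ^ 2 - s ^ 2 * S2) / (1 + (c * s) ^ 2)) with 0 in T.
    - rewrite exp_0, Rmult_1_r, pow_inv in T; auto.
    - rewrite Rpow_mult_distr, Hc2; unfold Rdiv.
      replace (INR N * (S2 * / INR N * s ^ 2) - s ^ 2 * S2) with 0 by (field; lra). ring. }
  assert (Kp := kern_int_pos (2 * length l)).
  assert (K2 := kern_int_sqr_lower (2 * length l)).
  rewrite mult_INR in K2; simpl (INR 2) in K2.
  set (K := kern_int (2 * length l)) in *.
  assert (0 < K / c) by (apply Rdiv_lt_0_compat; auto).
  split; [lra|].
  apply Rle_trans with ((K / c) ^ 2 * S2); [|apply Rmult_le_compat_r; [lra | apply pow_incr; lra]].
  replace ((K / c) ^ 2 * S2) with (K ^ 2 * (S2 / c ^ 2)) by (field; lra).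
  rewrite Hc2; replace (S2 / (S2 / INR N)) with (INR N) by (field; lra).
  apply Rle_trans with (2 * PI / (2 * INR (length l) + 1) * INR N).
  - apply Rle_trans with (PI * (2 * INR N / (2 * INR (length l) + 1))); [|right; field; lra].
    rewrite <- (Rmult_1_r PI) at 1; apply Rmult_le_compat_l; [generalize PI_RGT_0; lra|].
    apply Rle_div_r; lra.
  - apply Rmult_le_compat_r; [lra | exact K2].
Qed.

(** * The upper bound by Bernoulli's inequality *)

Lemma exp_le_compat (x y : R) : x <= y -> exp x <= exp y.
Proof.
  intros [H| ->]; [left; apply exp_increasing; auto | right; reflexivity].
Qed.

(** The tangent of [exp] at [t * z] is evaluated at [z] and at [0], then averaged with weights [t]
    and [1 - t]. For [z = ln (1 + x)] this is Bernoulli's inequality [(1 + x)^t <= 1 + t x]. *)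
Lemma exp_le_chord (t z : R) : 0 <= t <= 1 -> exp (t * z) <= 1 - t + t * exp z.
Proof.
  intros Ht.
  assert (H1 := exp_ineq1_le ((1 - t) * z)). assert (H2 := exp_ineq1_le (- (t * z))).
  assert (E1 : exp z = exp (t * z) * exp ((1 - t) * z))
    by (rewrite <- exp_plus; f_equal; ring).
  assert (E2 : 1 = exp (t * z) * exp (- (t * z)))
    by (rewrite <- exp_plus, Rplus_opp_r, exp_0; reflexivity).
  assert (P := exp_pos (t * z)).
  assert (A1 : exp (t * z) * (1 + (1 - t) * z) <= exp z) by (rewrite E1; apply Rmult_le_compat_l; lra).
  assert (A2 : exp (t * z) * (1 + - (t * z)) <= 1) by (rewrite E2 at 2; apply Rmult_le_compat_l; lra).
  assert (B1 := Rmult_le_compat_l t _ _ (proj1 Ht) A1).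
  assert (B2 := Rmult_le_compat_l (1 - t) _ _ ltac:(lra) A2).
  lra.
Qed.

(** Bernoulli with exponent [(b / a)^2 <= 1] bounds each factor by a power of [1 / (1 + (s / b)^2)];
    the exponents add up to [b^2 * inv_sqr_sum l]. *)
Lemma lorentz_prod_le_exp (l : list R) (b s : R) :
  0 < b -> (forall x, In x l -> b <= x) ->
  lorentz_prod l s <= exp (- (b ^ 2 * inv_sqr_sum l * ln (1 + (s / b) ^ 2))).
Proof.
  intros Hb; induction l as [|a l IH]; intros Hp.
  - simpl; rewrite Rmult_0_r, Rmult_0_l, Ropp_0, exp_0; lra.
  - assert (Ha : b <= a) by (apply Hp; simpl; auto).
    specialize (IH (fun x Hx => Hp x (or_intror Hx))).
    change (lorentz_prod (a :: l) s) with (/ (1 + (s / a) ^ 2) * lorentz_prod l s).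
    change (inv_sqr_sum (a :: l)) with (/ a ^ 2 + inv_sqr_sum l).
    assert (0 <= (s / b) ^ 2) by apply pow2_ge_0.
    assert (0 <= (s / a) ^ 2) by apply pow2_ge_0.
    set (z := ln (1 + (s / b) ^ 2)) in *.
    replace (- (b ^ 2 * (/ a ^ 2 + inv_sqr_sum l) * z))
      with (- ((b / a) ^ 2 * z) + - (b ^ 2 * inv_sqr_sum l * z)) by (field; lra).
    rewrite exp_plus; apply Rmult_le_compat; auto.
    + apply Rlt_le, Rinv_0_lt_compat; lra.
    + apply lorentz_prod_nonneg.
    + rewrite exp_Ropp; apply Rinv_le_contravar; [apply exp_pos|].
      assert (Hr : 0 <= b / a <= 1).
      { split; [apply Rdiv_le_0_compat; lra | apply Rle_div_l; lra]. }
      eapply Rle_trans; [apply exp_le_chord; split; [apply pow2_ge_0 | nra]|].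
      unfold z; rewrite exp_ln by lra.
      right; field; lra.
Qed.

Lemma kern_exp (m : nat) (s : R) : kern m s = exp (- (INR m / 2 * ln (1 + s ^ 2))).
Proof.
  unfold kern; rewrite <- Rpower_sqrt by nra; rewrite exp_Ropp.
  f_equal; rewrite <- Rpower_pow by apply exp_pos.
  rewrite Rpower_mult; unfold Rpower; f_equal; field.
Qed.

Lemma pv_int_lorentz_upper (l : list R) (b I : R) :
  0 < b -> (forall x, In x l -> b <= x) -> 2 < b ^ 2 * inv_sqr_sum l -> 0 < I ->
  pv_int (lorentz_prod l) I ->
  I ^ 2 * inv_sqr_sum l
  <= 2 * PI * (b ^ 2 * inv_sqr_sum l) / (2 * (b ^ 2 * inv_sqr_sum l) - 3).
Proof.
  intros Hb Hp HM HI0 HI; set (M := b ^ 2 * inv_sqr_sum l) in *.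
  (* The bound just obtained is a kernel of real index [2 * M]. Rounding the index down to an
     integer [m] only enlarges it, and [M > 2] guarantees [m >= 3]. With [m = p + 3] the Wallis
     bound is [2 PI / (p + 1)], where [p + 1 > 2 * M - 3]. *)
  destruct (nfloor_ex (2 * M)) as [m [Hm1 Hm2]]; [lra|].
  assert (Hm : (3 < S m)%nat) by (apply INR_lt; rewrite (S_INR m); simpl; lra).
  destruct m as [|[|[|p]]]; try lia.
  assert (HK : pv_int (fun s => kern (S (S (S p))) (/ b * s)) (kern_int (S p) / / b)).
  { apply pv_int_dilate; [apply Rinv_0_lt_compat; auto | apply pv_int_kern]. }
  assert (Hle : I <= kern_int (S p) / / b).
  { refine (pv_int_le _ _ _ _ _ HI HK); intros s; cbv beta.
    eapply Rle_trans; [exact (lorentz_prod_le_exp l b s Hb Hp)|].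
    rewrite kern_exp. replace (/ b * s) with (s / b) by (unfold Rdiv; ring).
    fold M.
    assert (0 <= (s / b) ^ 2) by apply pow2_ge_0.
    assert (0 <= ln (1 + (s / b) ^ 2)) by (rewrite <- ln_1; apply ln_le; lra).
    apply exp_le_compat, Ropp_le_contravar, Rmult_le_compat_r; lra. }
  assert (Kp := kern_int_pos (S p)).
  assert (K2 := kern_int_sqr_upper p).
  rewrite !S_INR in Hm2. assert (Hp0 := pos_INR p). assert (HPI := PI_RGT_0).
  set (K := kern_int (S p)) in *.
  replace (K / / b) with (K * b) in Hle by (field; lra).
  assert (HS : 0 < inv_sqr_sum l).
  { apply Rmult_lt_reg_l with (b ^ 2); [nra | fold M; lra]. }
  apply Rle_trans with ((K * b) ^ 2 * inv_sqr_sum l).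
  - apply Rmult_le_compat_r; [lra | apply pow_incr; lra].
  - replace ((K * b) ^ 2 * inv_sqr_sum l) with (K ^ 2 * M) by (unfold M; ring).
    replace (2 * PI * M / (2 * M - 3)) with (2 * PI / (2 * M - 3) * M) by (field; lra).
    apply Rmult_le_compat_r; [lra|].
    eapply Rle_trans; [exact K2|].
    apply Rmult_le_compat_l; [lra|]. apply Rinv_le_contravar; lra.
Qed.

(** * Estimates for the sum of inverse squared rates *)

Lemma wgt_inv_sqr (alpha : R) (k : nat) :
  / wgt alpha k ^ 2 = Rpower (INR k) (- (2 * alpha)).
Proof.
  unfold wgt; rewrite Rpower_Ropp; f_equal.
  rewrite <- Rpower_pow by apply exp_pos; rewrite Rpower_mult; f_equal; simpl; ring.
Qed.

Lemma ln_le_minus_1 (x : R) : 0 < x -> ln x <= x - 1.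
Proof. intros Hx; generalize (exp_ineq1_le (ln x)); rewrite exp_ln by auto; lra. Qed.

(** The convex function [t^(-b)] lies above its tangent at [x]. Used with [y = x + 1] and
    [y = x - 1], this compares the power sum with a telescoping sum from either side, in place of an
    integral. *)
Lemma Rpower_neg_convex (b x y : R) :
  0 < b -> 0 < x -> 0 < y ->
  Rpower x (- b) - Rpower y (- b) <= b * (y - x) * Rpower x (- (b + 1)).
Proof.
  intros Hb Hx Hy.
  assert (E : Rpower y (- b) = Rpower x (- b) * exp (- b * ln (y / x))).
  { unfold Rpower; rewrite <- exp_plus, ln_div by auto; f_equal; ring. }
  assert (E1 : Rpower x (- (b + 1)) = Rpower x (- b) * / x).
  { replace (- (b + 1)) with (- b + - (1)) by ring.
    rewrite Rpower_plus, (Rpower_Ropp x 1), Rpower_1 by auto; reflexivity. }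
  assert (H := exp_ineq1_le (- b * ln (y / x))).
  assert (L := ln_le_minus_1 (y / x) ltac:(apply Rdiv_lt_0_compat; auto)).
  assert (P : 0 < Rpower x (- b)) by apply exp_pos.
  rewrite E, E1.
  apply Rle_trans with (Rpower x (- b) * (b * (y / x - 1))).
  - assert (1 - exp (- b * ln (y / x)) <= b * (y / x - 1)) by nra.
    replace (Rpower x (- b) - Rpower x (- b) * exp (- b * ln (y / x)))
      with (Rpower x (- b) * (1 - exp (- b * ln (y / x)))) by ring.
    apply Rmult_le_compat_l; lra.
  - right; field; lra.
Qed.

Lemma inv_sqr_sum_rates_lower (alpha : R) (a n : nat) :
  1 < alpha -> (1 <= a <= n)%nat ->
  Rpower (INR a) (- (2 * alpha - 1)) - Rpower (INR (S n)) (- (2 * alpha - 1))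
  <= (2 * alpha - 1) * inv_sqr_sum (rates alpha a n).
Proof.
  intros Hal [Ha Hn]; unfold rates; replace (S n) with (a + (S n - a))%nat at 1 by lia.
  generalize (S n - a)%nat; intros d; clear n Hn.
  revert a Ha; induction d as [|d IH]; intros a Ha.
  - rewrite Nat.add_0_r; simpl; lra.
  - specialize (IH (S a) ltac:(lia)).
    replace (S a + d)%nat with (a + S d)%nat in IH by lia.
    change (inv_sqr_sum (map (wgt alpha) (seq a (S d))))
      with (/ wgt alpha a ^ 2 + inv_sqr_sum (map (wgt alpha) (seq (S a) d))).
    rewrite wgt_inv_sqr.
    assert (0 < INR a) by (apply lt_0_INR; lia).
    assert (H1 := Rpower_neg_convex (2 * alpha - 1) (INR a) (INR (S a)) ltac:(lra) H
      ltac:(apply lt_0_INR; lia)).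
    rewrite (S_INR a) in H1 at 2.
    replace (- (2 * alpha - 1 + 1)) with (- (2 * alpha)) in H1 by ring.
    lra.
Qed.

Lemma inv_sqr_sum_rates_upper (alpha : R) (a n : nat) :
  1 < alpha -> (1 <= a <= n)%nat ->
  (2 * alpha - 1) * inv_sqr_sum (rates alpha a n)
  <= (2 * alpha - 1) * Rpower (INR a) (- (2 * alpha)) + Rpower (INR a) (- (2 * alpha - 1)).
Proof.
  intros Hal [Ha Hn]; rewrite rates_cons by auto.
  change (inv_sqr_sum (?x :: ?l)) with (/ x ^ 2 + inv_sqr_sum l).
  rewrite wgt_inv_sqr, Rmult_plus_distr_l; apply Rplus_le_compat_l.
  unfold rates; generalize (S n - S a)%nat; intros d; clear n Hn.
  apply Rle_trans with (Rpower (INR a) (- (2 * alpha - 1))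
    - Rpower (INR (a + d)) (- (2 * alpha - 1))).
  2: { assert (0 < Rpower (INR (a + d)) (- (2 * alpha - 1))) by apply exp_pos. lra. }
  revert a Ha; induction d as [|d IH]; intros a Ha.
  - rewrite Nat.add_0_r; simpl; lra.
  - specialize (IH (S a) ltac:(lia)).
    replace (S a + d)%nat with (a + S d)%nat in IH by lia.
    change (inv_sqr_sum (map (wgt alpha) (seq (S a) (S d))))
      with (/ wgt alpha (S a) ^ 2 + inv_sqr_sum (map (wgt alpha) (seq (S (S a)) d))).
    rewrite wgt_inv_sqr.
    assert (0 < INR a) by (apply lt_0_INR; lia).
    assert (H1 := Rpower_neg_convex (2 * alpha - 1) (INR (S a)) (INR a) ltac:(lra)
      ltac:(apply lt_0_INR; lia) H).
    rewrite (S_INR a) in H1 at 2.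
    replace (- (2 * alpha - 1 + 1)) with (- (2 * alpha)) in H1 by ring.
    lra.
Qed.

Lemma scaled_inv_sqr_sum_bounds (alpha : R) (a n : nat) :
  1 < alpha -> (1 <= a <= n)%nat ->
  1 - INR a / INR n
  <= (2 * alpha - 1) * inv_sqr_sum (rates alpha a n) * Rpower (INR a) (2 * alpha - 1)
  <= 1 + (2 * alpha - 1) / INR a.
Proof.
  intros Hal Ha.
  assert (L := inv_sqr_sum_rates_lower alpha a n Hal Ha).
  assert (U := inv_sqr_sum_rates_upper alpha a n Hal Ha).
  assert (Pa : 0 < INR a) by (apply lt_0_INR; lia).
  assert (Pn : INR a <= INR n) by (apply le_INR; lia).
  assert (Pg : 0 < Rpower (INR a) (2 * alpha - 1)) by apply exp_pos.
  apply (Rmult_le_compat_r (Rpower (INR a) (2 * alpha - 1))) in L; [|lra].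
  apply (Rmult_le_compat_r (Rpower (INR a) (2 * alpha - 1))) in U; [|lra].
  set (b := 2 * alpha - 1) in *. assert (Hb : 1 < b) by (unfold b; lra).
  assert (E0 : Rpower (INR a) (- b) * Rpower (INR a) b = 1)
    by (rewrite <- Rpower_plus, Rplus_opp_l, Rpower_O by auto; reflexivity).
  split.
  - eapply Rle_trans; [|exact L].
    rewrite Rmult_minus_distr_r, E0.
    apply Rplus_le_compat_l, Ropp_le_contravar.
    assert (Pn' : 0 < INR (S n)) by (apply lt_0_INR; lia).
    replace (Rpower (INR (S n)) (- b) * Rpower (INR a) b) with (Rpower (INR a / INR (S n)) b).
    2: { unfold Rpower; rewrite <- exp_plus, ln_div by auto; f_equal; ring. }
    assert (Q : 0 < INR a / INR (S n)) by (apply Rdiv_lt_0_compat; auto).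
    assert (Q1 : INR a / INR (S n) <= 1).
    { apply Rle_div_l; [auto | rewrite S_INR; lra]. }
    (* The base is at most 1 and the exponent [b] exceeds 1, so the power is at most its base. *)
    apply Rle_trans with (INR a / INR (S n)).
    + rewrite <- (Rpower_1 (INR a / INR (S n))) at 2 by auto.
      unfold Rpower; apply exp_le_compat.
      assert (ln (INR a / INR (S n)) <= 0) by (rewrite <- ln_1; apply ln_le; auto).
      nra.
    + apply Rmult_le_compat_l; [lra|]. apply Rinv_le_contravar; [lra | rewrite S_INR; lra].
  - eapply Rle_trans; [exact U|].
    rewrite Rmult_plus_distr_r, E0, Rmult_assoc, <- Rpower_plus.
    replace (- (2 * alpha) + b) with (- (1)) by (unfold b; ring).
    rewrite Rpower_Ropp, Rpower_1 by auto. right; field; lra.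
Qed.

(** * Assembling the bounds into the limit of the ratio *)

Definition bingo_asymptotics (alpha : R) (a n : nat) : R :=
  sqrt ((2 * alpha - 1) / PI) * Rpower (INR a) ((2 * alpha - 1) / 2) * Rpower (INR n) (- alpha).

(** In the notation of the proof, [r^2 = I^2 * S2 / (PI * q)] with [q] between [1 - delta] and
    [1 + delta]. The lower bound on [I] gives [1 / q]. Since [M = q * INR a / b], the upper bound
    gives [2 / (2 * q - 3 * (b / INR a))], whose denominator is at least [2 - 5 * delta]. *)
Lemma bingo_ratio_bounds (alpha delta : R) (a n : nat) :
  1 < alpha -> (1 <= a <= n)%nat -> 0 < delta <= / 10 ->
  INR a / INR n <= delta -> (2 * alpha - 1) / INR a <= delta ->
  let r := BINGO alpha a a n n / bingo_asymptotics alpha a n in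
  0 < r /\ 1 - delta <= r ^ 2 <= 2 / (2 - 5 * delta).
Proof.
  intros Hal Ha Hd Hn Hb r.
  assert (PI0 := PI_RGT_0).
  assert (Pa : 0 < INR a) by (apply lt_0_INR; lia).
  assert (Pn : 0 < INR n) by (apply lt_0_INR; lia).
  assert (HI := pv_int_bingo alpha a n ltac:(lra) Ha).
  set (I := PI * wgt alpha n * BINGO alpha a a n n) in *.
  assert (Q := scaled_inv_sqr_sum_bounds alpha a n Hal Ha).
  set (l := rates alpha a n) in *.
  set (b := 2 * alpha - 1) in *. assert (Pb : 1 < b) by (unfold b; lra).
  set (S2 := inv_sqr_sum l) in *.
  set (g := Rpower (INR a) b) in *. assert (Pg : 0 < g) by apply exp_pos.
  set (q := b * S2 * g) in *.
  assert (HL : 0 < I /\ PI <= I ^ 2 * S2).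
  { assert (Hp := rates_pos alpha a n).
    unfold S2, l in *; rewrite rates_cons in * by lia.
    apply pv_int_lorentz_lower; auto. }
  assert (EM : wgt alpha a ^ 2 * S2 = q * INR a / b).
  { replace (wgt alpha a ^ 2) with (g * INR a).
    - unfold q; field; lra.
    - unfold g, wgt, b; rewrite <- Rpower_pow, Rpower_mult by apply exp_pos.
      rewrite <- (Rpower_1 (INR a)) at 2 by auto.
      rewrite <- Rpower_plus; f_equal; simpl; ring. }
  assert (Pba : 0 < b / INR a) by (apply Rdiv_lt_0_compat; lra).
  (* [q >= 9/10] and [b / INR a <= 1/10], so this quotient is at least 9. *)
  assert (HM : 2 < q * INR a / b).
  { replace (q * INR a / b) with (q / (b / INR a)) by (field; lra).
    apply Rlt_div_r; [auto | lra]. }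
  assert (HU := pv_int_lorentz_upper l (wgt alpha a) I (wgt_pos _ _)).
  fold S2 in HU; rewrite EM in HU.
  specialize (HU ltac:(
    intros x Hx; apply in_map_iff in Hx; destruct Hx as [k [<- Hk]];
    apply in_seq in Hk; destruct (Nat.eq_dec a k) as [->|Hak]; [lra|];
    apply Rlt_le, wgt_lt; [lra | lia]) HM (proj1 HL) HI).
  destruct HL as [PI1 HL].
  assert (Er : r = I / (PI * (sqrt (b / PI) * Rpower (INR a) (b / 2)))).
  { unfold r, I, bingo_asymptotics; fold b; rewrite Rpower_Ropp; fold (wgt alpha n).
    assert (0 < wgt alpha n) by apply wgt_pos.
    assert (0 < Rpower (INR a) (b / 2)) by apply exp_pos.
    assert (0 < sqrt (b / PI)) by (apply sqrt_lt_R0, Rdiv_lt_0_compat; lra).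
    field; repeat split; lra. }
  assert (Pden : 0 < PI * (sqrt (b / PI) * Rpower (INR a) (b / 2))).
  { apply Rmult_lt_0_compat; auto. apply Rmult_lt_0_compat; [|apply exp_pos].
    apply sqrt_lt_R0, Rdiv_lt_0_compat; lra. }
  assert (Eden : (PI * (sqrt (b / PI) * Rpower (INR a) (b / 2))) ^ 2 = PI * b * g).
  { rewrite !Rpow_mult_distr, <- (Rsqr_pow2 (sqrt _)), Rsqr_sqrt
      by (apply Rdiv_le_0_compat; lra).
    replace (Rpower (INR a) (b / 2) ^ 2) with g.
    - field; lra.
    - unfold g; rewrite <- Rpower_pow, Rpower_mult by apply exp_pos; f_equal; simpl; field. }
  assert (PS : 0 < S2).
  { apply Rmult_lt_reg_l with (I ^ 2); [apply pow_lt; auto | lra]. }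
  assert (Pq : 0 < q) by lra.
  assert (Er2 : r ^ 2 = I ^ 2 * S2 / (PI * q)).
  { rewrite Er; unfold Rdiv at 1; rewrite Rpow_mult_distr, pow_inv, Eden.
    unfold q; field; repeat split; lra. }
  split; [rewrite Er; apply Rdiv_lt_0_compat; auto|].
  rewrite Er2; split.
  - apply Rle_div_r; [nra|].
    apply Rle_trans with PI; [|exact HL].
    rewrite <- (Rmult_1_r PI) at 2.
    replace ((1 - delta) * (PI * q)) with (PI * ((1 - delta) * q)) by ring.
    apply Rmult_le_compat_l; [lra | nra].
  - apply Rle_trans with (2 / (2 * q - 3 * (b / INR a))).
    + apply Rle_div_l; [nra|].
      eapply Rle_trans; [exact HU|].
      right; field; repeat split; try lra.
      * intros E. assert (2 * q * INR a - 3 * b = 0) by lra.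
        assert (2 * q - 3 * (b / INR a) = 0); [|lra].
        replace (2 * q - 3 * (b / INR a)) with ((2 * q * INR a - 3 * b) / INR a) by (field; lra).
        rewrite H; field; lra.
    + apply Rmult_le_compat_l; [lra|]. apply Rinv_le_contravar; lra.
Qed.

Theorem mainTheorem8 (alpha : R) (A : nat -> nat)
  (halpha : 1 < alpha)
  (hApos : forall n, (1 <= A n)%nat)
  (hAinf : forall M : nat, exists N : nat, forall n, (N <= n)%nat -> (M <= A n)%nat)
  (hAo : forall eps : R, 0 < eps -> exists N : nat, forall n, (N <= n)%nat ->
           INR (A n) <= eps * INR n) :
  Un_cv (fun n : nat =>
           BINGO alpha (A n) (A n) n n /
           (sqrt ((2 * alpha - 1) / PI)
            * Rpower (INR (A n)) ((2 * alpha - 1) / 2)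
            * Rpower (INR n) (- alpha))) 1.
Proof.
  intros eps Heps.
  (* Then [5 * delta] is at most [eps / 2] and at most [1 / 2], which makes [2 / (2 - 5 * delta)]
     smaller than [1 + eps]. *)
  set (delta := Rmin eps 1 / 10).
  assert (Hd : 0 < delta /\ delta <= eps / 10 /\ delta <= / 10).
  { unfold delta; generalize (Rmin_l eps 1) (Rmin_r eps 1) (Rmin_pos eps 1 Heps Rlt_0_1); lra. }
  destruct Hd as [Hd0 [Hde Hd1]].
  (* Once [A n >= S M], the quotient [(2 * alpha - 1) / INR (A n)] is below [delta]. *)
  destruct (nfloor_ex ((2 * alpha - 1) / delta)) as [M [_ HM]].
  { apply Rdiv_le_0_compat; lra. }
  destruct (hAinf (S M)) as [N1 H1].
  destruct (hAo delta Hd0) as [N2 H2].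
  exists (S (N1 + N2)); intros n Hn.
  specialize (H1 n ltac:(lia)); specialize (H2 n ltac:(lia)).
  assert (Pa : 0 < INR (A n)) by (apply lt_0_INR; specialize (hApos n); lia).
  assert (Pn : 0 < INR n) by (apply lt_0_INR; lia).
  assert (Hle : (A n <= n)%nat) by (apply INR_le; nra).
  apply le_INR in H1; rewrite S_INR in H1.
  destruct (bingo_ratio_bounds alpha delta (A n) n) as [Pr [Lr Ur]]; auto.
  - apply Rle_div_l; auto.
  - apply Rle_div_l; auto.
    apply Rmult_lt_compat_r with (r := delta) in HM; auto.
    unfold Rdiv in HM at 1; rewrite Rmult_assoc, Rinv_l in HM by lra. nra.
  - unfold bingo_asymptotics in *.
    set (r := BINGO _ _ _ _ _ / _) in *.
    assert (U : 2 / (2 - 5 * delta) < 1 + eps) by (apply Rlt_div_l; nra).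
    (* For positive [r], the value [r] lies between [1] and [r^2], so the bounds on the square carry
       over to [r]. *)
    unfold Rdist; apply Rabs_def1; nra.
Qed.
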